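(* For every formula $\theta$ of $\mathcal{L}_{\square\Diamond}$, the formula $\square\neg\neg\theta\to\neg\neg\square\theta$ is valid in every Gödel–Kripke model $\langle W,S,e\rangle$ whose set of worlds $W$ is finite.
   Context: $\mathcal{L}_{\square\Diamond}$ is the set of formulas built from a set $Var$ of propositional variables using $\wedge,\to,\bot,\square,\Diamond$, with $\neg\varphi:=\varphi\to\bot$. On $[0,1]$, $a\cdot b=\min\{a,b\}$, $a\Rightarrow b=1$ if $a\le b$ and $=b$ otherwise. A Gödel–Kripke model $\langle W,S,e\rangle$ has a nonempty set $W$, arbitrary $S:W\times W\to[0,1]$ and $e:W\times Var\to[0,1]$, extended by $e(x,\varphi\wedge\psi)=e(x,\varphi)\cdot e(x,\psi)$, $e(x,\varphi\to\psi)=e(x,\varphi)\Rightarrow e(x,\psi)$, $e(x,\bot)=0$, $e(x,\square\varphi)=\inf_{y\in W}\{Sxy\Rightarrow e(y,\varphi)\}$, $e(x,\Diamond\varphi)=\sup_{y\in W}\{Sxy\cdot e(y,\varphi)\}$. A formula is valid in the model if $e(x,\varphi)=1$ for every $x\in W$. *)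

(* Defs.v *)
From mathcomp Require Import all_boot all_order all_algebra.
From mathcomp Require Import all_classical all_reals.

Set Implicit Arguments.
Unset Strict Implicit.
Unset Printing Implicit Defensive.

Import Order.TTheory GRing.Theory Num.Theory.

Local Open Scope classical_set_scope.
Local Open Scope ring_scope.

Inductive formula (Var : Type) : Type :=
| FVar of Var
| FBot
| FAnd of formula Var & formula Var
| FImp of formula Var & formula Var
| FBox of formula Var
| FDia of formula Var.

Arguments FBot {Var}.

Definition FNeg (Var : Type) (phi : formula Var) : formula Var :=
  FImp phi FBot.

Definition gmul (R : realType) (a b : R) : R := Num.min a b.

Definition gimp (R : realType) (a b : R) : R := if a <= b then 1 else b.

(* Truth degrees are carried by R itself; the bounds put them in [0, 1]. *)
Record gkmodel (R : realType) (Var : Type) : Type := GKModel {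
  world : Type;
  access : world -> world -> R;
  valuation : world -> Var -> R;
  world_nonempty : inhabited world;
  access_itv : forall x y : world, 0 <= access x y <= 1;
  valuation_itv : forall (x : world) (p : Var), 0 <= valuation x p <= 1
}.

(* The sets under inf and sup are nonempty and bounded by 0 and 1 (see
   eval_itv), so the defaults of inf and sup in R are never used. *)
Fixpoint eval (R : realType) (Var : Type) (M : gkmodel R Var)
    (x : world M) (phi : formula Var) {struct phi} : R :=
  match phi with
  | FVar p => valuation x p
  | FBot => 0
  | FAnd phi1 phi2 => gmul (eval x phi1) (eval x phi2)
  | FImp phi1 phi2 => gimp (eval x phi1) (eval x phi2)
  | FBox phi1 => inf [set gimp (access x y) (eval y phi1) | y in [set: world M]]
  | FDia phi1 => sup [set gmul (access x y) (eval y phi1) | y in [set: world M]]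
  end.

Definition valid_in (R : realType) (Var : Type) (M : gkmodel R Var)
    (phi : formula Var) : Prop :=
  forall x : world M, eval x phi = 1.

Definition finite_gkmodel (R : realType) (Var : Type) (M : gkmodel R Var)
    : Prop :=
  finite_set [set: world M].

Lemma gmul_itv (R : realType) (a b : R) :
  0 <= a <= 1 -> 0 <= b <= 1 -> 0 <= gmul a b <= 1.
Proof.
move=> /andP[a0 a1] /andP[b0 b1]; rewrite /gmul.
by rewrite le_min a0 b0 ge_min a1.
Qed.

Lemma gimp_itv (R : realType) (a b : R) :
  0 <= b <= 1 -> 0 <= gimp a b <= 1.
Proof. by move=> b01; rewrite /gimp; case: ifP; rewrite // ler01 lexx. Qed.

Lemma eval_itv (R : realType) (Var : Type) (M : gkmodel R Var)
    (x : world M) (phi : formula Var) : 0 <= eval x phi <= 1.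
Proof.
elim: phi x => [p||f IHf g IHg|f IHf g IHg|f IHf|f IHf] x /=.
- exact: valuation_itv.
- by rewrite lexx ler01.
- exact: gmul_itv.
- exact: gimp_itv.
- have h y : 0 <= gimp (access x y) (eval y f) <= 1 by apply: gimp_itv.
  apply/andP; split.
    apply: lb_le_inf; first by exists (gimp (access x x) (eval x f)), x.
    by move=> _ [y _ <-]; case/andP: (h y).
  have /andP[_] := h x; apply: le_trans; apply: ge_inf; last by exists x.
  by exists 0 => _ [y _ <-]; case/andP: (h y).
- have h y : 0 <= gmul (access x y) (eval y f) <= 1.
    by apply: gmul_itv => //; apply: access_itv.
  apply/andP; split.
    have /andP[h0 _] := h x; apply: (le_trans h0); apply: ub_le_sup.
      by exists 1 => _ [y _ <-]; case/andP: (h y).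
    by exists x.
  apply: ge_sup; first by exists (gmul (access x x) (eval x f)), x.
  by move=> _ [y _ <-]; case/andP: (h y).
Qed.

(* Main.v *)
(* The double negation of a truth degree a in [0, 1] is 1 if a > 0 and 0 if
   a = 0.  Over a finite set of worlds the infimum defining Box theta is
   attained, so if Box theta vanishes at x, then theta vanishes at some world y
   with S x y > 0; there the double negation of theta vanishes as well, hence
   so does Box (neg neg theta) at x. *)
Require Import Defs.
From mathcomp Require Import all_boot all_order all_algebra.
From mathcomp Require Import all_classical all_reals.

Import Order.TTheory GRing.Theory Num.Theory.

Local Open Scope classical_set_scope.
Local Open Scope ring_scope.

(** Induction on an enumerating sequence yields a least member; being a member and a lower bound, it
    is the infimum. *)
Lemma inf_mem_finite (R : realType) (A : set R) :
  finite_set A -> A !=set0 -> A (inf A).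
Proof.
move=> /finite_seqP[s ->] [a /= a_s].
have [m ms mP] : exists2 m, m \in s & forall y, y \in s -> m <= y.
  elim: s a a_s => // b s IHs _ _.
  (* The induction hypothesis asks for a member of the tail, so a one-element sequence is treated
     apart. *)
  case: s IHs => [_|c s IHs].
    by exists b => [|y]; rewrite inE // => /eqP ->.
  have [m ms mP] := IHs c (mem_head c s).
  exists (Num.min b m).
    by rewrite minEle; case: ifP; rewrite inE ?eqxx // ms orbT.
  move=> y; rewrite inE => /predU1P[->|/mP my]; first by rewrite ge_min lexx.
  by rewrite ge_min my orbT.
suff -> : inf [set` s] = m by [].
apply/eqP; rewrite eq_le; apply/andP; split.
  by apply: ge_inf => //; exists m => y /mP.
by apply: lb_le_inf; [exists m | move=> y /mP].
Qed.

Lemma gimp_le (R : realType) (a b : R) : a <= b -> gimp a b = 1.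
Proof. by rewrite /gimp => ->. Qed.

Lemma gimp_gt (R : realType) (a b : R) : b < a -> gimp a b = b.
Proof. by rewrite /gimp leNgt => ->. Qed.

Lemma gimp_eq0 (R : realType) (a b : R) : gimp a b = 0 -> 0 < a /\ b = 0.
Proof.
rewrite /gimp; case: (leP a b) => [_ /eqP|b_lt_a b0].
  by rewrite oner_eq0.
by rewrite -{1}b0.
Qed.

Lemma eval_negneg (R : realType) (Var : Type) (M : gkmodel R Var)
    (x : world M) (phi : formula Var) :
  eval x (FNeg (FNeg phi)) = gimp (gimp (eval x phi) 0) 0.
Proof. by []. Qed.

Lemma eval_box_le (R : realType) (Var : Type) (M : gkmodel R Var)
    (x y : world M) (phi : formula Var) :
  eval x (FBox phi) <= gimp (access x y) (eval y phi).
Proof.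
apply: ge_inf; last by exists y.
by exists 0 => _ [z _ <-]; have /andP[] := gimp_itv (access x z) (eval_itv z phi).
Qed.

(** Finiteness of the model enters here: over infinitely many worlds the infimum can be 0 although
    every term is positive. *)
Lemma eval_box_attained (R : realType) (Var : Type) (M : gkmodel R Var)
    (x : world M) (phi : formula Var) : finite_gkmodel M ->
  exists y, gimp (access x y) (eval y phi) = eval x (FBox phi).
Proof.
move=> finM.
have [||y _ xyE] := inf_mem_finite _
  [set gimp (access x y) (eval y phi) | y in [set: world M]]; last by exists y.
- exact: finite_image.
- by exists (gimp (access x x) (eval x phi)), x.
Qed.

Theorem theorem12 (R : realType) (Var : Type) (theta : formula Var)
    (M : gkmodel R Var) (finM : finite_gkmodel M) :
  valid_in M (FImp (FBox (FNeg (FNeg theta))) (FNeg (FNeg (FBox theta)))).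
Proof.
move=> x; set A := FBox _; set B := FBox theta.
suff AB : eval x A <= eval x (FNeg (FNeg B)).
  by rewrite [LHS]/(gimp (eval x A) (eval x (FNeg (FNeg B)))) /gimp AB.
have /andP[B_ge0 _] := eval_itv x B.
have [B_gt0|B_le0] := ltP 0 (eval x B).
  by rewrite eval_negneg (gimp_gt _ _ _ B_gt0) gimp_le //; have /andP[] := eval_itv x A.
(* In the remaining case it suffices to bound the value of [A] by 0. *)
have /andP[nnB_ge0 _] := eval_itv x (FNeg (FNeg B)); apply: le_trans nnB_ge0.
have B0 : eval x B = 0 by apply/le_anti/andP.
have [y] := eval_box_attained _ _ _ x theta finM.
rewrite -/B B0 => /gimp_eq0[Sxy_gt0 y0].
(* The term at [y] alone bounds the infimum for [A]: its conclusion is 0 and [access x y] is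
   positive, so the implication is 0. *)
apply: le_trans (eval_box_le _ _ _ x y _) _.
by rewrite eval_negneg y0 [gimp 0 0]gimp_le // [gimp 1 0]gimp_gt ?ltr01 // gimp_gt.
Qed.
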